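(* $Ps$-normality is a topological property: if $X$ is a $Ps$-normal topological space and $Z$ is a topological space homeomorphic to $X$, then $Z$ is $Ps$-normal.
   Context: A topological space is normal if any two disjoint closed subsets are contained in disjoint open sets (no $T_1$ assumption). A topological space is pseudocompact if every real-valued continuous function on it is bounded; a subset is called pseudocompact if it is pseudocompact in the subspace topology. A space $X$ is $Ps$-normal if there exist a normal space $Y$ and a bijection $f:X\to Y$ such that $f|_K:K\to f(K)$ is a homeomorphism (subspace topologies) for every pseudocompact subset $K$ of $X$. *)

(* Defs.v *)
From HB Require Import structures.
From mathcomp Require Import all_boot all_order all_algebra.
From mathcomp Require Import all_classical all_reals all_analysis.
Import Order.TTheory GRing.Theory Num.Theory.
Import numFieldNormedType.Exports.

Set Implicit Arguments.
Unset Strict Implicit.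
Unset Printing Implicit Defensive.

Local Open Scope classical_set_scope.
Local Open Scope ring_scope.

Definition homeomorphism (X Y : topologicalType) (f : X -> Y) : Prop :=
  continuous f /\
  exists g : Y -> X, [/\ cancel f g, cancel g f & continuous g].

Definition homeomorphic (X Y : topologicalType) : Prop :=
  exists f : X -> Y, homeomorphism f.

(* [R] is the field of real numbers; it is a parameter because the library
   treats the reals through the interface [realType]. *)
Definition pseudocompact (R : realType) (X : topologicalType) : Prop :=
  forall f : X -> R, continuous f -> bounded_fun f.

(* A set [K] coerces to the type [set_type K] of its points, whose canonical
   topology is the genuine subspace topology (unlike that of [subspace K],
   which is a topology on the whole ambient type). *)
Definition pseudocompact_set (R : realType) (X : topologicalType)
  (K : set X) : Prop := pseudocompact R K.

(* [sigLR [fun f in K]] is the map K -> f(K) induced by [f]. The library's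
   [normal_space] assumes no T1 axiom; [normal_openP] relates it to the
   separation of disjoint closed sets by disjoint open sets. *)
Definition Ps_normal (R : realType) (X : topologicalType) : Prop :=
  exists (Y : topologicalType) (f : X -> Y),
    [/\ normal_space Y, bijective f &
        forall K : set X, pseudocompact_set R K ->
          homeomorphism (sigLR [fun f in K] : K -> f @` K)].

(* Main.v *)
(** A homeomorphism [h : X -> Z] with inverse [g] restricts to homeomorphisms
    between [K] and [g @` K] for every [K] in [Z], and therefore preserves
    pseudocompactness of subsets. If [f : X -> Y] witnesses that [X] is
    Ps-normal, then [f \o g : Z -> Y] is a witness for [Z]. *)
Require Import Defs.
From mathcomp Require Import all_boot all_order all_algebra.
From mathcomp Require Import all_classical all_reals all_analysis.

Import numFieldNormedType.Exports.

Set Implicit Arguments.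
Unset Strict Implicit.
Unset Printing Implicit Defensive.

Local Open Scope classical_set_scope.

Lemma homeomorphism_comp (X Y Z : topologicalType) (f : X -> Y) (g : Y -> Z) :
  homeomorphism f -> homeomorphism g -> homeomorphism (g \o f).
Proof.
move=> [cf [f' [fK f'K cf']]] [cg [g' [gK g'K cg']]]; split.
  by move=> x; apply: continuous_comp; [exact: cf|exact: cg].
exists (f' \o g'); split; [exact: can_comp|exact: can_comp|].
by move=> x; apply: continuous_comp; [exact: cg'|exact: cf'].
Qed.

(** A real function [u] on [Y] takes the same values as its pullback [u \o f], because [f] is onto;
    so any bound for the pullback also bounds [u]. *)
Lemma pseudocompact_homeomorphism (R : realType) (X Y : topologicalType)
    (f : X -> Y) :
  homeomorphism f -> pseudocompact R X -> pseudocompact R Y.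
Proof.
move=> [cf [g [_ gK _]]] cX u cu.
have [M [Mreal uM]] : bounded_fun (u \o f).
  by apply: cX => x; apply: continuous_comp; [exact: cf|exact: cu].
exists M; split=> // x Mx y _.
by have := uM _ Mx (g y) I; rewrite /= gK.
Qed.

Lemma sigLRE (X Y : Type) (A : set X) (B : set Y) (f : {fun A >-> B}) (x : A) :
  set_val (sigLR f x) = f (set_val x).
Proof. by []. Qed.

Lemma continuous_sigLR (X Y : topologicalType) (A : set X) (B : set Y)
    (f : {fun A >-> B}) :
  continuous f -> continuous (sigLR f : A -> B).
Proof.
(* The topology of [B] is initial for its inclusion, so continuity can be tested after composing
   with [set_val]. *)
move=> cf; apply: continuous_comp_initial => x.
apply: (@continuous_comp _ _ _ (set_val : A -> X) f); last exact: cf.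
exact: initial_continuous.
Qed.

Lemma homeomorphism_sigLR (X Y : topologicalType) (A : set X) (f : X -> Y) :
  homeomorphism f -> homeomorphism (sigLR [fun f in A] : A -> f @` A).
Proof.
move=> [cf [g [fK gK cg]]].
have gA : {homo g : y / (f @` A) y >-> A y}.
  by move=> _ [x Ax <-]; rewrite fK.
split; first exact: continuous_sigLR.
exists (sigLR (mkfun_fun gA)); split; last exact: continuous_sigLR.
- by move=> x; apply: val_inj; rewrite -!set_valE !sigLRE; exact: fK.
- by move=> y; apply: val_inj; rewrite -!set_valE !sigLRE; exact: gK.
Qed.

Lemma homeomorphism_sigLR_comp (X Y Z : topologicalType) (A : set X)
    (f : X -> Y) (g : Y -> Z) :
  homeomorphism (sigLR [fun f in A] : A -> f @` A) ->
  homeomorphism (sigLR [fun g in f @` A] : f @` A -> g @` (f @` A)) ->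
  homeomorphism (sigLR (funin A (g \o f)) : A -> (g \o f) @` A).
Proof.
move=> hf /(homeomorphism_comp hf).
set u := (u in homeomorphism u).
have uE x : set_val (u x) = (g \o f) (set_val x) by [].
(* With the body of [u] forgotten, its codomain can be rewritten; [uE] still determines [u], as
   [set_val] is injective. *)
move: u uE; rewrite image_comp => u uE.
congr homeomorphism; apply/funext => x; apply: val_inj.
by rewrite -!set_valE uE.
Qed.

Theorem theorem2p4 (R : realType) (X Z : topologicalType)
  (hX : Ps_normal R X) (hXZ : homeomorphic X Z) : Ps_normal R Z.
Proof.
move: hX hXZ => [Y [f [nY bf fP]]] [h [ch [g [hK gK cg]]]].
have hg : homeomorphism g by split=> //; exists h.
exists Y, (f \o g); split=> //; first by apply: bij_comp => //; exists h.
move=> K pK.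
have hgK := homeomorphism_sigLR K hg.
apply: homeomorphism_sigLR_comp => //.
by apply: fP; exact: pseudocompact_homeomorphism hgK pK.
Qed.
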